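(* The (reduced) symmetrized topological complexity of the circle $S^1$ is $2$: $\mathrm{TC}^{\Sigma}(S^1)=2$.
   Context: For a topological space $X$, let $PX$ denote the space of all paths $\sigma:[0,1]\to X$ (with the compact-open topology), and let $p:PX\to X\times X$ be $p(\sigma)=(\sigma(0),\sigma(1))$. For $V\subset X\times X$, a motion planning rule on $V$ is a (continuous) section $s:V\to PX$ of $p$ over $V$, i.e. $p(s(x,y))=(x,y)$ for all $(x,y)\in V$. A set $V\subset X\times X$ is symmetric if $(x,y)\in V$ iff $(y,x)\in V$. A motion planning rule $s$ on a symmetric set $V$ is symmetric if $s(x_1,x_0)=\overline{s(x_0,x_1)}$ for all $(x_0,x_1)\in V$, where $\overline{\sigma}(t)=\sigma(1-t)$. The (reduced) symmetrized topological complexity $\mathrm{TC}^{\Sigma}(X)$ is $1$ less than the minimal number of symmetric open sets covering $X\times X$ each of which admits a symmetric motion planning rule. *)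

(* Defs.v *)
From HB Require Import structures.
From mathcomp Require Import all_boot all_order all_algebra.
From mathcomp Require Import all_classical all_reals all_analysis.

Set Implicit Arguments.
Unset Strict Implicit.
Unset Printing Implicit Defensive.

Import Order.TTheory GRing.Theory Num.Theory.
Import numFieldTopology.Exports numFieldNormedType.Exports.

Local Open Scope classical_set_scope.
Local Open Scope ring_scope.

Section SymmetrizedTC.
Variable R : realType.

Definition unit_interval : set R := `[0, 1]%classic.

Lemma unit_interval0 : unit_interval 0.
Proof. by rewrite /unit_interval /= in_itv /= lexx ler01. Qed.

Lemma unit_interval1 : unit_interval 1.
Proof. by rewrite /unit_interval /= in_itv /= lexx ler01. Qed.

Definition I0 : set_type unit_interval := SigSub (mem_set unit_interval0).
Definition I1 : set_type unit_interval := SigSub (mem_set unit_interval1).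

Lemma unit_intervalB1 (t : set_type unit_interval) :
  unit_interval (1 - \val t).
Proof.
have := set_valP t; rewrite /unit_interval /= !in_itv /= => /andP[t0 t1].
by rewrite subr_ge0 t1 lerBlDr lerDl t0.
Qed.

Definition time_reversal (t : set_type unit_interval) : set_type unit_interval :=
  SigSub (mem_set (unit_intervalB1 t)).

Lemma time_reversal_continuous : continuous time_reversal.
Proof.
apply: continuous_comp_initial => t.
apply: (@continuousB _ R^o _ (cst 1) (fun x : set_type unit_interval => \val x)).
  exact: cst_continuous.
exact: (@initial_continuous _ _ (@set_val R unit_interval)).
Qed.

HB.instance Definition _ :=
  isContinuous.Build _ _ time_reversal time_reversal_continuous.

Section Space.
Variable X : topologicalType.

Definition path_space : Type := continuousType (set_type unit_interval) X.

HB.instance Definition _ := Choice.on path_space.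
HB.instance Definition _ := Topological.copy path_space
  (initial_topology
     (fun sigma : path_space =>
        (sigma : set_type unit_interval -> X)
          : {compact-open, set_type unit_interval -> X})).

Definition endpoints (sigma : path_space) : X * X := (sigma I0, sigma I1).

Definition reverse (sigma : path_space) : path_space := sigma \o time_reversal.

Definition symmetric_set (V : set (X * X)) : Prop :=
  forall x y, V (x, y) <-> V (y, x).

(* Rules on [V] are total functions [X * X -> path_space] of which only the
   restriction to [V] matters. *)
Definition motion_planning_rule (V : set (X * X)) (s : X * X -> path_space) :=
  {within V, continuous s} /\ forall v, V v -> endpoints (s v) = v.

Definition symmetric_rule (V : set (X * X)) (s : X * X -> path_space) :=
  forall x0 x1, V (x0, x1) -> s (x1, x0) = reverse (s (x0, x1)).

Definition symmetric_planning_cover (n : nat) : Prop :=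
  exists V : 'I_n -> set (X * X),
    (forall i, [/\ open (V i), symmetric_set (V i) &
       exists s, motion_planning_rule (V i) s /\ symmetric_rule (V i) s]) /\
    \bigcup_i V i = [set: X * X].

(* [+oo] when no finite cover exists; the value is an integer rather than a
   natural number because the empty space has a cover by 0 sets. *)
Definition TCSigma : \bar int :=
  if pselect (exists n, `[< symmetric_planning_cover n >]) is left e
  then ((ex_minn e)%:Z - 1)%:E else +oo%E.

Lemma TCSigmaP (k : nat) : TCSigma = (k%:Z)%:E <->
  symmetric_planning_cover k.+1 /\
  forall n, symmetric_planning_cover n -> (k < n)%N.
Proof.
rewrite /TCSigma; case: pselect => [e|ne]; last first.
  by split=> // -[c _]; case: ne; exists k.+1; apply/asboolP.
case: ex_minnP => m /asboolP cm mmin; split=> [[/eqP]|[ck kmin]].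
  rewrite subr_eq -PoszD eqz_nat addn1 => /eqP mk; rewrite -mk; split=> // n cn.
  by apply: mmin; apply/asboolP.
have -> : m = k.+1.
  by apply/eqP; rewrite eqn_leq (kmin _ cm) mmin //; apply/asboolP.
by rewrite -addn1 PoszD addrK.
Qed.

End Space.

Definition circle : topologicalType :=
  set_type [set p : R * R | p.1 ^+ 2 + p.2 ^+ 2 = 1].

End SymmetrizedTC.


Arguments unit_interval R : clear implicits.
Arguments circle R : clear implicits.

(* Main.v *)
(* A symmetric motion planning rule over [V] amounts to a continuous choice,
   odd under the swap, of the angular displacement from [x] to [y] for
   [(x, y)] in [V].

   Two sets do not suffice.  Write [x = exp(i a)] and [y = exp(i b)]; a
   displacement [d] is congruent to [b - a] modulo [2 pi], so over each of the
   two sets the sign of [d - (b - a) + pi] is locally constant; it is positive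
   on the diagonal.  The triangle [0 <= a <= b <= 2 pi] is the quotient of the
   torus by the swap, a Moebius band, cut open; across the cut the signs are
   opposite.
   Labelling a fine grid of the triangle by pairs (set, sign) maps it to the
   boundary of a square, antipodal vertices having opposite signs.  The winding
   number along the boundary of the triangle is zero because the map extends
   inside; yet the diagonal contributes nothing and the other two edges
   contribute the same odd number of half turns.

   Three sets suffice: normalise the segment from [x] to [y] where [y <> - x];
   near the pairs [(x, - x)], push the segment aside in a fixed direction [e],
   where the components of [x] and [y] orthogonal to [e] have opposite signs. *)
Require Import Defs.
From HB Require Import structures.
From mathcomp Require Import all_boot all_order all_algebra.
From mathcomp Require Import all_classical all_reals all_analysis.
From mathcomp Require Import zify lra ring.

Set Implicit Arguments.
Unset Strict Implicit.
Unset Printing Implicit Defensive.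

Import Order.TTheory GRing.Theory Num.Theory.
Import numFieldTopology.Exports numFieldNormedType.Exports.

Local Open Scope classical_set_scope.
Local Open Scope ring_scope.

(** * Antipodal labellings *)

(* A label [(b, s)] stands for the set of index [b] and sign [s]; [true] is
   the positive sign. *)
Definition label := (bool * bool)%type.

Definition opp_label (x : label) : label := (x.1, ~~ x.2).

(* The four labels in cyclic order around the boundary of the square with
   vertices [+e0, +e1, -e0, -e1]. *)
Definition label_code (x : label) : nat := (x.1 + (~~ x.2).*2)%N.

(** Signed number of quarter turns; the default 0 also covers antipodal labels, which [compatible]
    excludes. *)
Definition turn (x y : label) : int :=
  match ((label_code y + 4 - label_code x) %% 4)%N with
  | 1 => 1 | 3 => -1 | _ => 0
  end.

Definition compatible (x y : label) := y != opp_label x.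

Lemma opp_labelK : involutive opp_label.
Proof. by case=> [[] []]. Qed.

Lemma compatible_opp x y :
  compatible (opp_label x) (opp_label y) = compatible x y.
Proof. by case: x y => [[] []] [[] []]. Qed.

Lemma turn_opp x y : turn (opp_label x) (opp_label y) = turn x y.
Proof. by case: x y => [[] []] [[] []]. Qed.

(** Any three distinct vertices of a square include an antipodal pair, so pairwise compatible labels
    lie on one edge and cannot wind. *)
Lemma turn_triangle x y z : compatible x y -> compatible y z ->
  compatible x z -> turn x y + turn y z = turn x z.
Proof. by case: x y z => [[] []] [[] []] [[] []]. Qed.

Lemma turn_mod4 x y : compatible x y ->
  exists k : int, turn x y = (label_code y)%:Z - (label_code x)%:Z + 4 * k.
Proof.
case: x y => [[] []] [[] []] //= _; rewrite /turn /label_code /=;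
  solve [by exists 0 | by exists 1 | by exists (-1)].
Qed.

(** Positive labels have codes 0 and 1: nothing wraps around modulo 4, so sums along the diagonal
    telescope. *)
Lemma turn_positive (x y : label) : x.2 -> y.2 ->
  turn x y = (label_code y)%:Z - (label_code x)%:Z.
Proof. by case: x y => [[] []] [[] []]. Qed.

(* Tucker's lemma for a triangulated Moebius band, cut open to a triangle:
   the boundary edge [i = j] is labelled positively and the other two edges are
   glued with opposite labels. *)
Lemma no_antipodal_labelling (n : nat) (l : nat -> nat -> label) :
  (forall i j, (i <= j < n)%N -> compatible (l i j) (l i j.+1)) ->
  (forall i j, (i < j <= n)%N -> compatible (l i j) (l i.+1 j)) ->
  (forall i j, (i <= j < n)%N -> compatible (l i j) (l i.+1 j.+1)) ->
  (forall i, (i <= n)%N -> l i n = opp_label (l 0%N i)) ->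
  (forall i, (i <= n)%N -> (l i i).2) -> False.
Proof.
move=> vert horiz diag glue pos.
(* [A j], [B j] and [C j] add the turns along the three sides of the triangle with vertices (0, 0),
   (0, j) and (j, j). *)
pose A j := \sum_(0 <= k < j) turn (l 0%N k) (l 0%N k.+1).
pose B j := \sum_(0 <= i < j) turn (l i j) (l i.+1 j).
pose C j := \sum_(0 <= k < j) turn (l k k) (l k.+1 k.+1).
(* Each grid square is cut by its diagonal into two triangles, across which [turn_triangle] moves
   the path. *)
have strip j k : (k <= j < n)%N ->
    turn (l 0%N j) (l 0%N j.+1) +
      \sum_(0 <= i < k) turn (l i j.+1) (l i.+1 j.+1) =
    \sum_(0 <= i < k) turn (l i j) (l i.+1 j) + turn (l k j) (l k j.+1).
  elim: k => [|k IH] kj; first by rewrite !big_geq // addr0 add0r.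
  rewrite !big_nat_recr //= addrA IH; last by lia.
  rewrite -!addrA; congr (_ + _).
  by rewrite !turn_triangle ?vert ?horiz ?diag //; lia.
have ABC j : (j <= n)%N -> A j + B j = C j.
  elim: j => [|j IH] jn; first by rewrite /A /B /C !big_geq.
  rewrite /A /B /C !big_nat_recr //= -/(A j) -/(C j) -IH; last by lia.
  rewrite -!addrA; congr (_ + _); rewrite addrA strip; last by lia.
  by rewrite -addrA turn_triangle ?vert ?horiz ?diag //; lia.
have BA : B n = A n.
  rewrite /A /B !big_mkord; apply: eq_bigr => i _.
  by rewrite !glue ?turn_opp // ltnW.
have C0 : C n = 0.
  suff CE j : (j <= n)%N -> C j =
      (label_code (l j j))%:Z - (label_code (l 0%N 0%N))%:Z.
    by rewrite CE // !glue // opp_labelK subrr.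
  elim: j => [|j IH] jn; first by rewrite /C big_geq // subrr.
  rewrite /C big_nat_recr //= -/(C j) IH; last by lia.
  by rewrite turn_positive ?pos //; lia.
have AE j : (j <= n)%N -> exists k : int, A j =
    (label_code (l 0%N j))%:Z - (label_code (l 0%N 0%N))%:Z + 4 * k.
  elim: j => [|j IH] jn; first by exists 0; rewrite /A big_geq //; lia.
  have [k Ak] := IH (ltnW jn).
  have [m tm] : exists m : int, turn (l 0%N j) (l 0%N j.+1) =
      (label_code (l 0%N j.+1))%:Z - (label_code (l 0%N j))%:Z + 4 * m.
    by apply: turn_mod4; apply: vert; lia.
  exists (k + m); rewrite /A big_nat_recr //= -/(A j) Ak tm; lia.
have [k Ak] := AE n (leqnn n).
have A0 : A n = 0 by move: (ABC n (leqnn n)); rewrite BA C0; lia.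
(* Gluing makes the labels at (0, 0) and (0, n) antipodal, so [A n] would be 2 modulo 4. *)
move: Ak; rewrite A0 glue //.
by case: (l 0%N 0%N) => [[] []]; rewrite /label_code /=; lia.
Qed.

(** * Angles on the circle *)

Section CircleGeometry.
Variable R : realType.
Implicit Types (p q r : circle R) (a b x t : R).

Definition cx p : R := (\val p).1.
Definition cy p : R := (\val p).2.

Lemma circleE p : cx p ^+ 2 + cy p ^+ 2 = 1.
Proof. exact: set_valP p. Qed.

Lemma circle_eq p q : cx p = cx q -> cy p = cy q -> p = q.
Proof.
rewrite /cx /cy => h1 h2; apply: val_inj.
by rewrite [LHS]surjective_pairing [RHS]surjective_pairing h1 h2.
Qed.

Definition circle_point (u v : R) (uv1 : u ^+ 2 + v ^+ 2 = 1) : circle R :=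
  SigSub (mem_set (uv1 : [set p : R * R | p.1 ^+ 2 + p.2 ^+ 2 = 1] (u, v))).

Lemma cx_continuous : continuous cx.
Proof.
move=> p; apply: (@continuous_comp (circle R) (R * R)%type R \val fst).
  exact: (@initial_continuous _ _ (@set_val (R * R)%type _)).
exact: cvg_fst.
Qed.

Lemma cy_continuous : continuous cy.
Proof.
move=> p; apply: (@continuous_comp (circle R) (R * R)%type R \val snd).
  exact: (@initial_continuous _ _ (@set_val (R * R)%type _)).
exact: cvg_snd.
Qed.

Lemma cvg_circle (T : Type) (F : set_system T) (f : T -> circle R) p :
  Filter F -> cx (f t) @[t --> F] --> cx p -> cy (f t) @[t --> F] --> cy p ->
  f @ F --> p.
Proof.
move=> FF fx fy U [_ [[W oW <-]] Wp] /filterS; apply.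
have : (cx (f t), cy (f t)) @[t --> F] --> (cx p, cy p).
  exact: (cvg_pair fx fy).
move=> /(_ W) h; have : nbhs (cx p, cy p) W.
  apply: open_nbhs_nbhs; split=> //; move: Wp.
  by rewrite /= /cx /cy -surjective_pairing.
move=> /h FW; have := @filterS _ F FF _ (f @^-1` (\val @^-1` W)) _ FW.
apply => t.
by rewrite /= /cx /cy -surjective_pairing.
Qed.

(** * Dot products, cross products and signed angles *)

Definition dot p q : R := cx p * cx q + cy p * cy q.
Definition cross p q : R := cx p * cy q - cy p * cx q.
(** The signed angle from [p] to [q] only where [dot p q] is positive: the arcsine confuses an angle
    with its supplement. *)
Definition ang p q : R := asin (cross p q).

Lemma dot_cross p q : dot p q ^+ 2 + cross p q ^+ 2 = 1.
Proof.
have -> : dot p q ^+ 2 + cross p q ^+ 2 =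
    (cx p ^+ 2 + cy p ^+ 2) * (cx q ^+ 2 + cy q ^+ 2).
  by rewrite /dot /cross; ring.
by rewrite !circleE mulr1.
Qed.

Lemma dotpp p : dot p p = 1.
Proof. by rewrite -(circleE p) /dot !expr2. Qed.

Lemma crosspp p : cross p p = 0.
Proof. by rewrite /cross; ring. Qed.

(** The bound 4/5 keeps both angles below [pi / 4] and has the rational sine 3/5: the last dot
    product exceeds 16/25 - 9/25. *)
Lemma dot_gt0_trans p q r : 4 / 5 < dot p q -> 4 / 5 < dot p r -> 0 < dot q r.
Proof.
move=> pq pr.
have -> : dot q r = dot p q * dot p r + cross p q * cross p r.
  have -> : dot p q * dot p r + cross p q * cross p r =
    (cx p ^+ 2 + cy p ^+ 2) * dot q r by rewrite /dot /cross; ring.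
  by rewrite circleE mul1r.
have := dot_cross p q; have := dot_cross p r.
move: (dot p q) (dot p r) (cross p q) (cross p r) pq pr => u v c d uh vh e1 e2.
have c2 : c ^+ 2 < 9 / 25 by nra.
have d2 : d ^+ 2 < 9 / 25 by nra.
have : 0 <= (c + d) ^+ 2 by exact: sqr_ge0.
rewrite sqrrD => cd; nra.
Qed.

Lemma cross_bound p q : 0 < dot p q -> -1 < cross p q < 1.
Proof. by have := dot_cross p q => e h; apply/andP; split; nra. Qed.

Lemma sin_ang p q : 0 < dot p q -> sin (ang p q) = cross p q.
Proof.
by move=> /cross_bound /andP[h1 h2]; rewrite asinK // in_itv /= !ltW.
Qed.

Lemma cos_ang p q : 0 < dot p q -> cos (ang p q) = dot p q.
Proof.
move=> pq; have /andP[h1 h2] := cross_bound pq.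
rewrite cos_asin ?ltW // -(dot_cross p q) addrK sqrtr_sqr gtr0_norm //.
Qed.

Lemma angpp p : ang p p = 0.
Proof.
have := @pi_ge0 R => pi0.
by rewrite /ang crosspp -{1}(@sin0 R) sinK // in_itv /=; apply/andP; split; lra.
Qed.

Definition expi a : circle R := circle_point (cos2Dsin2 a).

Lemma cx_expi a : cx (expi a) = cos a. Proof. by []. Qed.
Lemma cy_expi a : cy (expi a) = sin a. Proof. by []. Qed.

Lemma expi_continuous : continuous expi.
Proof.
by move=> a; apply: cvg_circle; [exact: continuous_cos|exact: continuous_sin].
Qed.

Lemma expiD_ang a q : 0 < dot (expi a) q -> expi (a + ang (expi a) q) = q.
Proof.
move=> aq; apply: circle_eq; rewrite ?cx_expi ?cy_expi ?cosD ?sinD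
  cos_ang // sin_ang // /dot /cross cx_expi cy_expi.
  rewrite -[RHS]mul1r -(cos2Dsin2 a); ring.
rewrite -[RHS]mul1r -(cos2Dsin2 a); ring.
Qed.

Lemma expi_surj p : exists a, expi a = p.
Proof.
have cxB : -1 <= cx p <= 1 by have := circleE p => h; apply/andP; split; nra.
have sE : sin (acos (cx p)) = `|cy p|.
  rewrite sin_acos // -sqrtr_sqr; congr Num.sqrt.
  by rewrite -(circleE p); ring.
have cE : cos (acos (cx p)) = cx p by rewrite acosK // in_itv.
case: (leP 0 (cy p)) => h.
  exists (acos (cx p)); apply: circle_eq => //.
  by rewrite cy_expi sE ger0_norm.
exists (- acos (cx p)); apply: circle_eq; first by rewrite cx_expi cosN.
by rewrite cy_expi sinN sE ltr0_norm // opprK.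
Qed.

Lemma expi_2pi : expi (2 * pi) = expi 0.
Proof.
rewrite mulr_natl; apply: circle_eq; rewrite ?cx_expi ?cy_expi.
  by rewrite cos2pi cos0.
by rewrite sin2pi sin0.
Qed.

Lemma cvg_dot (T : Type) (F : set_system T) (f g : T -> circle R) p q :
  Filter F -> f @ F --> p -> g @ F --> q ->
  dot (f t) (g t) @[t --> F] --> dot p q.
Proof.
move=> FF fp gq; apply: cvgD; apply: cvgM.
- exact: (cvg_comp _ _ fp (@cx_continuous p)).
- exact: (cvg_comp _ _ gq (@cx_continuous q)).
- exact: (cvg_comp _ _ fp (@cy_continuous p)).
- exact: (cvg_comp _ _ gq (@cy_continuous q)).
Qed.

Lemma cvg_cross (T : Type) (F : set_system T) (f g : T -> circle R) p q :
  Filter F -> f @ F --> p -> g @ F --> q ->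
  cross (f t) (g t) @[t --> F] --> cross p q.
Proof.
move=> FF fp gq; apply: cvgB; apply: cvgM.
- exact: (cvg_comp _ _ fp (@cx_continuous p)).
- exact: (cvg_comp _ _ gq (@cy_continuous q)).
- exact: (cvg_comp _ _ fp (@cy_continuous p)).
- exact: (cvg_comp _ _ gq (@cx_continuous q)).
Qed.

Lemma cvg_ang (T : Type) (F : set_system T) (f g : T -> circle R) p q :
  Filter F -> f @ F --> p -> g @ F --> q -> 0 < dot p q ->
  ang (f t) (g t) @[t --> F] --> ang p q.
Proof.
move=> FF fp gq /cross_bound pq.
exact: (cvg_comp _ _ (cvg_cross FF fp gq) (continuous_asin pq)).
Qed.

Lemma cos_eq1_gtpi x : 0 < x -> cos x = 1 -> pi < x.
Proof.
move=> x0 cx1; rewrite ltNge; apply/negP => xpi.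
suff : x = 0 by move=> xE; rewrite xE ltxx in x0.
by apply: cos_inj; rewrite ?in_itv /= ?lexx ?pi_ge0 ?(ltW x0) // cos0.
Qed.

(* The difference of two lifts takes its values in the discrete set where the
   cosine is 1. *)
Lemma lift_unique (f g : R -> R) : continuous f -> continuous g ->
  (forall t, 0 <= t <= 1 -> expi (f t) = expi (g t)) ->
  f 1 - f 0 = g 1 - g 0.
Proof.
(* If [h] grew, its increment would exceed [pi], so [h] would take the value [h 0 + pi], where its
   cosine is -1. *)
have half (h : R -> R) : continuous h ->
    (forall t, 0 <= t <= 1 -> cos (h t) = 1) ->
    (forall t u, 0 <= t <= 1 -> 0 <= u <= 1 -> cos (h t - h u) = 1) ->
    ~ (h 0 < h 1).
  move=> hc h1 h2 h01.
  have := @cos_eq1_gtpi (h 1 - h 0).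
  rewrite subr_gt0 h2 ?lexx ?ler01 // => /(_ h01 erefl) hpi.
  have [||t] := @IVT R h 0 1 (h 0 + pi) ler01.
  - exact: continuous_subspaceT.
  - have := @pi_gt0 R => pi0.
    rewrite (min_idPl (ltW h01)) (max_idPr (ltW h01)).
    by apply/andP; split; lra.
  rewrite in_itv /= => t01 ht.
  have := h1 t t01; rewrite ht cosDpi h1 ?lexx ?ler01 //.
  lra.
move=> fc gc fg.
have ch (f' g' : R -> R) :
    (forall t, 0 <= t <= 1 -> expi (f' t) = expi (g' t)) ->
    forall t, 0 <= t <= 1 -> cos (f' t - g' t) = 1 /\ sin (f' t - g' t) = 0.
  move=> fg' t /fg' e; rewrite cosB sinB -!cx_expi -!cy_expi e.
  split; last by ring.
  by rewrite -!expr2 circleE.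
have cc (f' g' : R -> R) : continuous f' -> continuous g' ->
    (forall t, 0 <= t <= 1 -> expi (f' t) = expi (g' t)) ->
    ~ (f' 0 - g' 0 < f' 1 - g' 1).
  move=> fc' gc' /ch h; apply: (half (fun t => f' t - g' t)).
  - by move=> t; apply: cvgB; [exact: fc'|exact: gc'].
  - by move=> t /h [].
  move=> t u /h [e1 e2] /h [e3 e4].
  by rewrite cosB e1 e2 e3 e4 mulr1 mulr0 addr0.
have /negP := cc f g fc gc fg.
have /negP := cc g f gc fc (fun t h => esym (fg t h)).
rewrite -!leNgt; lra.
Qed.

End CircleGeometry.

(** * Lifting paths to the line *)

Lemma lebesgue_number (R : realType) (T : pseudoMetricType R) (I : Type)
    (K : set T) (U : I -> set T) :
  compact K -> (forall i, open (U i)) -> K `<=` \bigcup_i U i ->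
  exists2 e : R, 0 < e & forall x, K x -> exists i, ball x e `<=` U i.
Proof.
move=> /compact_near_coveringP cK oU KU.
(* The radius is a parameter tending to 0 from the right; compactness makes it uniform in [x]. *)
have : \forall e \near (0:R)^'+, K `<=` (fun x => exists i, ball x e `<=` U i).
  apply: (cK R _ (fun e x => exists i, ball x e `<=` U i)) => x /KU [i _ Uix].
  have /nbhs_ballP[e /= e0 eU] : nbhs x (U i) by apply: open_nbhs_nbhs; split.
  have e20 : 0 < e / 2 by rewrite divr_gt0.
  exists (ball x (e / 2), [set r | 0 < r < e / 2]).
    split; first exact: nbhsx_ballx.
    near=> r; apply/andP; split; near: r; first exact: nbhs_right_gt.
    exact: nbhs_right_lt.
  move=> [y r] /= [xy /andP[r0 re]]; exists i => z yz; apply: eU.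
  rewrite [e]splitr; apply: ball_triangle xy _.
  exact: le_ball (ltW re) _ yz.
move=> H.
have [e [e0 eH]] :
    exists e : R, 0 < e /\ K `<=` (fun x => exists i, ball x e `<=` U i).
  apply: (@filter_ex _ (0:R)^'+); apply: filterI => //.
  exact: nbhs_right_gt.
by exists e.
Unshelve. all: by end_near. Qed.

Section Lifting.
Variable R : realType.
Local Notation I := (set_type (unit_interval R)).
Local Notation paths := (path_space R (circle R)).
Implicit Types (s : paths) (t : R).

Lemma clamp_subproof t : unit_interval R (Num.max 0 (Num.min t 1)).
Proof.
rewrite /unit_interval /= in_itv /= le_max lexx /=.
by rewrite ge_max ler01 ge_min lexx orbT.
Qed.

(** Precomposition with [clamp] extends a path to the whole line, so that lifts are ordinary real
    functions. *)
Definition clamp t : I := SigSub (mem_set (clamp_subproof t)).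

Lemma clamp_continuous : continuous clamp.
Proof.
apply: continuous_comp_initial => t.
apply: (@continuous_max R R (cst 0) (fun t => Num.min t 1)).
  exact: cvg_cst.
by apply: (@continuous_min R R id (cst 1)); [exact: cvg_id|exact: cvg_cst].
Qed.

Lemma clamp_id t : 0 <= t <= 1 -> \val (clamp t) = t.
Proof. by move=> /andP[t0 t1]; rewrite /= (min_idPl t1) (max_idPr t0). Qed.

Lemma clampK (u : I) : clamp (\val u) = u.
Proof.
apply: val_inj; rewrite clamp_id //.
by have := set_valP u; rewrite /unit_interval /= in_itv.
Qed.

Lemma clamp_le0 t : t <= 0 -> clamp t = I0 R.
Proof.
move=> t0; apply: val_inj => /=.
by rewrite (min_idPl (le_trans t0 ler01)) (max_idPl t0).
Qed.

Lemma clamp_ge1 t : 1 <= t -> clamp t = I1 R.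
Proof.
by move=> t1; apply: val_inj => /=; rewrite (min_idPr t1) (max_idPr ler01).
Qed.

Lemma clampB1 t : 0 <= t <= 1 -> clamp (1 - t) = time_reversal (clamp t).
Proof.
move=> t01; apply: val_inj.
rewrite -[RHS]/(1 - \val (clamp t)) !clamp_id //.
by case/andP: t01 => t0 t1; apply/andP; split; lra.
Qed.

Lemma path_continuous s : continuous (s \o clamp).
Proof.
move=> t; apply: continuous_comp; first exact: clamp_continuous.
exact: (@cts_fun _ _ s).
Qed.

Definition is_lift s (f : R -> R) :=
  continuous f /\ forall t, 0 <= t <= 1 -> expi (f t) = s (clamp t).

(** Here [e] is a Lebesgue number for the cover by the times at which the path is close to a given
    one of its values. *)
Lemma path_subdivision s : exists2 e : R, 0 < e &
  forall t u, 0 <= t <= 1 -> `|t - u| < e ->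
    0 < dot (s (clamp t)) (s (clamp u)).
Proof.
pose U (t0 : R) := [set t | 4 / 5 < dot (s (clamp t0)) (s (clamp t))].
have oU t0 : open (U t0).
  apply: (@open_comp _ _ (fun t => dot (s (clamp t0)) (s (clamp t)))
    [set x | 4 / 5 < x]).
    move=> t _; apply: cvg_dot; first exact: cvg_cst.
    exact: path_continuous.
  exact: open_gt.
have [|e e0 eP] := @lebesgue_number R R R `[0, 1] U (@segment_compact R 0 1) oU.
  by move=> t _; exists t => //; rewrite /U /= dotpp; lra.
exists e => // t u t01 tu; have [|t0 t0U] := eP t.
  by rewrite /= in_itv.
apply: (dot_gt0_trans (p := s (clamp t0))); apply: t0U => //.
exact: ballxx.
Qed.

Lemma lift_exists s : exists f, is_lift s f.
Proof.
have [e e0 eP] := path_subdivision s.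
have [N Ne] : exists N : nat, (0 < N)%N /\ N%:R^-1 < e.
  have [N] := ltr_add_invr e0; rewrite add0r => h; exists N.+1; split=> //.
have [N0 {}Ne] := Ne.
have NR0 : 0 < N%:R :> R by rewrite ltr0n.
(* The induction lifts the path stopped at time j / N; at N / N nothing is cut off. *)
suff [f [fc fP]] : exists f : R -> R, continuous f /\
    forall t, 0 <= t <= 1 -> expi (f t) = s (clamp (Num.min t (N%:R / N%:R))).
  exists f; split=> // t t01; rewrite fP // divff ?gt_eqF //.
  by case/andP: t01 => _ /min_idPl ->.
have : (N <= N)%N by [].
(* Only the numerator varies; the number of pieces stays fixed. *)
elim: {1 3}N => [|j IH] jN.
  have [a aE] := expi_surj (s (I0 R)).
  exists (cst a); split; first by move=> t; exact: cvg_cst.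
  by move=> t /andP[t0 _]; rewrite mul0r (min_idPr t0) clamp_le0.
have [f [fc fP]] := IH (ltnW jN).
have minc (c : R) : continuous (fun t : R => Num.min t c).
  move=> t; apply: (@continuous_min R R id (cst c)); first exact: cvg_id.
  exact: cvg_cst.
have close t : 0 < dot (s (clamp (Num.min t (j%:R / N%:R))))
                      (s (clamp (Num.min t (j.+1%:R / N%:R)))).
  have jjN : j%:R / N%:R <= j.+1%:R / N%:R :> R.
    by rewrite ler_pM2r ?invr_gt0 // ler_nat.
  case: (leP t (j%:R / N%:R)) => [tj|jt].
    by rewrite (min_idPl (le_trans tj jjN)) dotpp ltr01.
  apply: eP.
    by rewrite divr_ge0 ?ler0n //= ler_pdivrMr // mul1r ler_nat ltnW.
  have jE : j.+1%:R / N%:R = j%:R / N%:R + N%:R^-1 :> R.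
    by rewrite -natr1 mulrDl mul1r.
  have lo : j%:R / N%:R <= Num.min t (j.+1%:R / N%:R) by rewrite le_min jjN ltW.
  have up : Num.min t (j.+1%:R / N%:R) <= j.+1%:R / N%:R.
    by rewrite ge_min lexx orbT.
  rewrite distrC ger0_norm ?subr_ge0 //; apply: le_lt_trans Ne.
  by rewrite lerBlDl -jE.
(* The correction vanishes up to time j / N, then adds the angle travelled since. *)
exists (fun t => f t + ang (s (clamp (Num.min t (j%:R / N%:R))))
                      (s (clamp (Num.min t (j.+1%:R / N%:R))))); split.
  move=> t; apply: cvgD; first exact: fc.
  by apply: cvg_ang; [| |exact: close];
    apply: (continuous_comp (minc _ t) (@path_continuous s _)).
by move=> t t01; rewrite -fP // expiD_ang // fP.
Qed.

(** The total signed angle swept by the path; by [displacementE] the chosen lift does not matter. *)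
Definition displacement s : R :=
  let f := projT1 (cid (lift_exists s)) in f 1 - f 0.

Lemma displacementE s f : is_lift s f -> displacement s = f 1 - f 0.
Proof.
rewrite /displacement; case: cid => g [gc gP] [fc fP] /=.
by apply: lift_unique => // t t01; rewrite gP // fP.
Qed.

Lemma displacement_reverse s : displacement (reverse s) = - displacement s.
Proof.
have [f [fc fP]] := lift_exists s.
rewrite (displacementE (s := s) (f := f)) //.
rewrite (displacementE (f := fun t => f (1 - t))).
  by rewrite subrr subr0; ring.
split=> [t|t t01].
  apply: (@continuous_comp _ _ _ (fun t => 1 - t) f); last exact: fc.
  by apply: cvgB; [exact: cvg_cst|exact: cvg_id].
rewrite fP; first by rewrite clampB1.
by case/andP: t01 => t0 t1; apply/andP; split; lra.
Qed.

Lemma expi_displacement s a : expi a = s (I0 R) ->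
  expi (a + displacement s) = s (I1 R).
Proof.
have [f fl] := lift_exists s; rewrite (displacementE fl); case: fl => fc fP.
have [e0 e1] : expi (f 0) = s (I0 R) /\ expi (f 1) = s (I1 R).
  by rewrite !fP ?lexx ?ler01 // clamp_le0 // clamp_ge1.
rewrite -e0 -e1 => h.
have c : cos a = cos (f 0) by have := congr1 (@cx R) h.
have d : sin a = sin (f 0) by have := congr1 (@cy R) h.
have := cos2Dsin2 (f 0) => h0.
apply: circle_eq; rewrite ?cx_expi ?cy_expi ?cosD ?sinD ?cosB ?sinB c d.
  by rewrite !cosN !sinN -[RHS]mulr1 -h0; ring.
by rewrite !cosN !sinN -[RHS]mulr1 -h0; ring.
Qed.

(** Sending a closed ball of times into an open arc is a compact-open condition; by compactness of
    [0, 1] finitely many of them control all times. *)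
Lemma near_path s : nbhs s [set s' : paths | forall t, 0 <= t <= 1 ->
  0 < dot (s (clamp t)) (s' (clamp t))].
Proof.
have /compact_near_coveringP/near_covering_withinP := @segment_compact R 0 1.
move=> /(_ _ (nbhs s)
  (fun (s' : paths) t => 0 < dot (s (clamp t)) (s' (clamp t))) _).
suff H : forall x : R, `[0, 1]%classic x ->
  filter_prod (nbhs x) (nbhs s) [set p : R * paths |
    `[0, 1]%classic p.1 -> 0 < dot (s (clamp p.1)) (p.2 (clamp p.1))].
  move=> /(_ H); apply: filterS => s' h t t01; apply: h.
  by rewrite /= in_itv.
move=> x _.
pose O := [set q | 4 / 5 < dot (s (clamp x)) q].
have oO : open O.
  apply: (@open_comp _ _ (fun q : circle R => dot (s (clamp x)) q)
    [set x | 4 / 5 < x]).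
    move=> q _; apply: (@cvg_dot R _ (nbhs q) (cst _) id); last exact: cvg_id.
    exact: cvg_cst.
  exact: open_gt.
have nO : nbhs ((s \o clamp) x) O.
  by apply: open_nbhs_nbhs; split=> //; rewrite /O /= dotpp; lra.
have := @path_continuous s x O nO.
move=> /nbhs_ballP[e /= e0 eO].
have e20 : 0 < e / 2 by rewrite divr_gt0.
pose K := clamp @` closed_ball x (e / 2).
have KO u : closed_ball x (e / 2) u -> O (s (clamp u)).
  move=> xu; apply: eO; apply: closed_ball_subset xu => //; lra.
have cK : compact K.
  apply: continuous_compact; last exact: closed_ballR_compact.
  exact: continuous_subspaceT clamp_continuous.
exists (ball x (e / 2), [set s' : paths | s' @` K `<=` O]).
  split; first exact: nbhsx_ballx.
  pose KO' := [set g : {compact-open, I -> circle R} | g @` K `<=` O].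
  have oKO : open KO' by exact: compact_open_open.
  apply: open_nbhs_nbhs; split; first by exists KO'.
  by move=> _ [_ [u xu <-] <-]; exact: KO.
move=> [t s'] /= [xt s'K] t01.
have xt' : closed_ball x (e / 2) t by exact: subset_closed_ball xt.
apply: (dot_gt0_trans (p := s (clamp x))); first exact: KO.
by apply: s'K; exists (clamp t) => //; exists t.
Qed.

(** A lift of [s] plus the pointwise angle from [s] to [s'] lifts [s'], so nearby displacements
    differ only through the ends. *)
Lemma displacement_near s : nbhs s [set s' : paths |
  displacement s' = displacement s + ang (s (I1 R)) (s' (I1 R)) -
                    ang (s (I0 R)) (s' (I0 R))].
Proof.
have [f fl] := lift_exists s; rewrite (displacementE fl).
have [fc fP] := fl.
apply: filterS (near_path s) => s' s'P.
pose g t := f t + ang (s (clamp t)) (s' (clamp t)).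
have dP t : 0 < dot (s (clamp t)) (s' (clamp t)).
  have := s'P (\val (clamp t)); rewrite clampK; apply.
  by have := set_valP (clamp t); rewrite /unit_interval /= in_itv.
rewrite /= (displacementE (f := g)).
  by rewrite /g clamp_ge1 // clamp_le0 //; ring.
split=> [t|t t01].
  by apply: cvgD; [exact: fc|apply: cvg_ang => //; exact: path_continuous].
by rewrite /g -fP // expiD_ang // fP.
Qed.

End Lifting.

(** * Two sets do not suffice *)

Section LowerBound.
Variable R : realType.
Local Notation S1 := (circle R).
Variables (V : bool -> set (S1 * S1)) (s : bool -> S1 * S1 -> path_space R S1).
Hypothesis V_open : forall b, open (V b).
Hypothesis V_cover : forall v, exists b, V b v.
Hypothesis V_sym : forall b, symmetric_set (V b).
Hypothesis s_rule : forall b, motion_planning_rule (V b) (s b).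
Hypothesis s_sym : forall b, symmetric_rule (V b) (s b).

Let torus (z : R * R) : S1 * S1 := (expi z.1, expi z.2).

Let disp (b : bool) (z : R * R) : R := displacement (s b (torus z)).

(* The displacement is congruent to [z.2 - z.1] modulo [2 * pi], so it never
   equals the threshold. *)
Let signed_set (l : label) : set (R * R) := [set z | V l.1 (torus z) /\
  if l.2 then z.2 - z.1 - pi < disp l.1 z else disp l.1 z < z.2 - z.1 - pi].

Let expi1_continuous : continuous (fun z : R * R => expi z.1).
Proof.
move=> z; apply: (@continuous_comp _ _ _ fst (@expi R)); first exact: cvg_fst.
exact: expi_continuous.
Qed.

Let expi2_continuous : continuous (fun z : R * R => expi z.2).
Proof.
move=> z; apply: (@continuous_comp _ _ _ snd (@expi R)); first exact: cvg_snd.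
exact: expi_continuous.
Qed.

Let torus_continuous : continuous torus.
Proof.
by move=> z; exact: (cvg_pair (@expi1_continuous z) (@expi2_continuous z)).
Qed.

Let s_ends b v : V b v -> s b v (I0 R) = v.1 /\ s b v (I1 R) = v.2.
Proof.
move=> /((s_rule b).2 v) h.
by split; [exact: (congr1 fst h)|exact: (congr1 snd h)].
Qed.

(** Near [z] the displacement changes only by the two end angles of [displacement_near], which tend
    to 0. *)
Let disp_continuous b z : V b (torus z) -> disp b w @[w --> z] --> disp b z.
Proof.
move=> Vz.
have sc : {for torus z, continuous (s b)}.
  have := (s_rule b).1; rewrite continuous_open_subspace //.
  by apply; rewrite inE.
have n1 : nbhs z [set w | V b (torus w)].
  by apply: torus_continuous; apply: open_nbhs_nbhs; split.
have n2 := torus_continuous (sc _ (displacement_near (s b (torus z)))).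
have [z1 z2] := s_ends Vz.
have lim : disp b z + ang (expi z.2) (expi w.2) - ang (expi z.1) (expi w.1)
    @[w --> z] -->
    disp b z + ang (expi z.2) (expi z.2) - ang (expi z.1) (expi z.1).
  apply: cvgB; first apply: cvgD; first exact: cvg_cst.
    by apply: cvg_ang; [exact: cvg_cst|exact: expi2_continuous|rewrite dotpp].
  by apply: cvg_ang; [exact: cvg_cst|exact: expi1_continuous|rewrite dotpp].
rewrite !angpp addr0 subr0 in lim; apply: cvg_trans lim; apply: near_eq_cvg.
apply: filterS2 n1 n2 => w Vw /= dw.
by rewrite /disp dw z1 z2 (s_ends Vw).1 (s_ends Vw).2.
Qed.

Let signed_set_open l : open (signed_set l).
Proof.
rewrite openE => z [Vz zl].
have n1 : nbhs z [set w | V l.1 (torus w)].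
  by apply: torus_continuous; apply: open_nbhs_nbhs; split.
have lim : disp l.1 w - (w.2 - w.1 - pi) @[w --> z] -->
           disp l.1 z - (z.2 - z.1 - pi).
  apply: cvgB; first exact: disp_continuous.
  by apply: cvgB; [apply: cvgB; [exact: cvg_snd|exact: cvg_fst]|exact: cvg_cst].
rewrite /signed_set /interior /=; case: l.2 zl => zl.
  apply: filterS2 n1 (lim [set x | 0 < x] _); last first.
    by apply: open_nbhs_nbhs; split; [exact: open_gt|rewrite /= subr_gt0].
  by move=> w Vw /=; rewrite subr_gt0.
apply: filterS2 n1 (lim [set x | x < 0] _); last first.
  by apply: open_nbhs_nbhs; split; [exact: open_lt|rewrite /= subr_lt0].
by move=> w Vw /=; rewrite subr_lt0.
Qed.

Let signed_set_cover z : exists l, signed_set l z.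
Proof.
have [b Vb] := V_cover (torus z).
have [z1 z2] := s_ends Vb.
have := expi_displacement (esym z1); rewrite z2 -/(disp b z) => h.
have hc : cos (z.1 + disp b z) = cos z.2 by have := congr1 (@cx R) h.
have hs : sin (z.1 + disp b z) = sin z.2 by have := congr1 (@cy R) h.
(* At the threshold the path would end at the antipode of its prescribed end. *)
have : disp b z != z.2 - z.1 - pi.
  apply/eqP => dE.
  have e : z.1 + disp b z = z.2 - pi by rewrite dE; ring.
  move: hc hs; rewrite e cosB sinB cospi sinpi => hc hs.
  by have := cos2Dsin2 z.2; nra.
case: ltgtP => // h' _; [exists (b, false)|exists (b, true)]; by split.
Qed.

Let signed_set_disjoint l z : signed_set l z -> ~ signed_set (opp_label l) z.
Proof.
case: l => b [] [/= _ h1] [/= _ h2]; have := lt_trans h1 h2; by rewrite ltxx.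
Qed.

Let disp_swap b x y : V b (torus (x, y)) -> disp b (y, x) = - disp b (x, y).
Proof. by move=> /s_sym h; rewrite /disp h displacement_reverse. Qed.

(** On the torus (x, 2 pi) is the swap of (0, x). Both the displacement and the threshold [x - pi]
    change sign, which reverses the inequality. *)
Let signed_set_glue l x : signed_set l (0, x) ->
  signed_set (opp_label l) (x, 2 * pi).
Proof.
have tE b : disp b (x, 2 * pi) = disp b (x, 0).
  by rewrite /disp /torus /= expi_2pi.
move=> [/= Vx h].
split; first by rewrite /= /torus /= expi_2pi; apply/V_sym.
rewrite /= tE disp_swap //; case: l.2 h => /= h; lra.
Qed.

(** The swap fixes (x, x), so the displacement equals its opposite; it is 0, above the threshold
    [- pi]. *)
Let signed_set_diag l x : signed_set l (x, x) -> l.2.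
Proof.
case: l => b [] // [/= Vx]; have := disp_swap Vx => h1 h2.
by have := @pi_gt0 R; lra.
Qed.

Lemma no_symmetric_pair_cover : False.
Proof.
pose K : set (R * R) := `[0, 2 * pi] `*` `[0, 2 * pi].
have cK : compact K by apply: compact_setX; exact: segment_compact.
have [|e e0 eP] := lebesgue_number cK signed_set_open.
  by move=> z _; have [l lz] := signed_set_cover z; exists l.
have [L LP] : {L : R * R -> label & forall z, K z ->
    ball z e `<=` signed_set (L z)}.
  apply: (@choice _ _ (fun z l => K z -> ball z e `<=` signed_set l)) => z.
  have [/eP [l lP]|nK] := pselect (K z); first by exists l.
  by exists (true, true).
have pi0 := @pi_gt0 R.
have [n [n0 ne]] : exists n : nat, (0 < n)%N /\ 2 * pi / n%:R < e.
  have e'0 : 0 < e / (2 * pi) by rewrite divr_gt0 // mulr_gt0.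
  have [N] := ltr_add_invr e'0; rewrite add0r => h; exists N.+1; split=> //.
  by rewrite mulrC -ltr_pdivlMr // mulr_gt0.
have nR0 : 0 < n%:R :> R by rewrite ltr0n.
pose d := 2 * pi / n%:R : R.
have d0 : 0 < d by rewrite divr_gt0 // mulr_gt0.
pose g (i : nat) : R := i%:R * d.
have g0 : g 0%N = 0 by rewrite /g mul0r.
have gn : g n = 2 * pi by rewrite /g /d mulrCA divff ?mulr1 // gt_eqF.
have gK i j : (i <= n)%N -> (j <= n)%N -> K (g i, g j).
  have gB k : (k <= n)%N -> 0 <= g k <= 2 * pi.
    move=> kn; apply/andP; split; first by apply: mulr_ge0; rewrite ?ler0n ?ltW.
    by rewrite -gn; apply: ler_wpM2r; [exact: ltW|rewrite ler_nat].
  by move=> /gB hi /gB hj; split; rewrite /= in_itv.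
pose near_index i i' := (i' == i) || (i' == i.+1).
have gball i j i' j' : near_index i i' -> near_index j j' ->
    ball (g i, g j) e (g i', g j').
  have gb k k' : near_index k k' -> ball (g k) e (g k').
    move=> /orP[] /eqP ->; first exact: ballxx.
    rewrite /ball /= /g -natr1 mulrDl mul1r opprD addNKr normrN gtr0_norm //.
  by move=> /gb hi /gb hj; split.
(* Labels on the edge [j = n] are dictated by the gluing; the corner (n, n) is glued twice and gets
   the label of (0, 0). *)
pose l i j := if (j < n)%N then L (g i, g j)
  else if (i < n)%N then opp_label (L (g 0%N, g i)) else L (g 0%N, g 0%N).
have lball i j : (i <= j < n)%N -> ball (g i, g j) e `<=` signed_set (l i j).
  by move=> /andP[ij jn]; rewrite /l jn; apply: LP; apply: gK; lia.
have lmem i j : (i <= j <= n)%N -> signed_set (l i j) (g i, g j).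
  move=> /andP[ij jn]; have [jn'|nj] := ltnP j n.
    by apply: lball; [rewrite ij|exact: ballxx].
  have -> : j = n by lia.
  have Lm k : (k < n)%N -> signed_set (L (g 0%N, g k)) (0, g k).
    move=> kn; rewrite -[X in signed_set _ (X, _)]g0.
    apply: LP; last exact: ballxx.
    by apply: gK => //; lia.
  rewrite /l ltnn gn; case: ltnP => [ii|ni].
    by apply: signed_set_glue; exact: Lm.
  have -> : g i = 2 * pi by rewrite -gn; congr g; lia.
  rewrite -[L _]opp_labelK; apply: signed_set_glue; apply: signed_set_glue.
  by have := Lm _ n0; rewrite g0.
(* The ball around the first vertex contains the second, which opposite labels would place in two
   disjoint sets. *)
have lcompat i j i' j' : (i <= j < n)%N -> (i' <= j' <= n)%N ->
    near_index i i' -> near_index j j' -> compatible (l i j) (l i' j').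
  move=> ij ij' ii' jj'; apply/eqP => lE.
  apply: (@signed_set_disjoint (l i j) (g i', g j')).
    by apply: lball => //; exact: gball.
  by rewrite -lE; exact: lmem.
have lglue i : (i <= n)%N -> l i n = opp_label (l 0%N i).
  move=> ile; rewrite /l ltnn n0; case: ltnP => // ni.
  by rewrite opp_labelK.
apply: (@no_antipodal_labelling n l) => //.
- by move=> i j ij; apply: lcompat; rewrite /near_index ?eqxx ?orbT //; lia.
- move=> i j /andP[ij jn]; have [jn'|nj] := ltnP j n.
    by apply: lcompat; rewrite /near_index ?eqxx ?orbT //; lia.
  (* No ball is attached to vertices with [j = n]; gluing moves the comparison to the edge
     [i = 0]. *)
  have -> : j = n by lia.
  rewrite !lglue ?compatible_opp; try lia.
  by apply: lcompat; rewrite /near_index ?eqxx ?orbT //; lia.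
- by move=> i j ij; apply: lcompat; rewrite /near_index ?eqxx ?orbT //; lia.
- by move=> i ile; apply: (@signed_set_diag _ (g i)); apply: lmem; lia.
Qed.

End LowerBound.

(** * Three sets suffice *)

Section UpperBound.
Variable R : realType.
Local Notation S1 := (circle R).
Local Notation I := (set_type (unit_interval R)).

Lemma normalize_subproof (u v : R) : 0 < u ^+ 2 + v ^+ 2 ->
  (u / Num.sqrt (u ^+ 2 + v ^+ 2)) ^+ 2 +
  (v / Num.sqrt (u ^+ 2 + v ^+ 2)) ^+ 2 = 1.
Proof.
by move=> h; rewrite !expr_div_n sqr_sqrtr ?ltW // -mulrDl divff // gt_eqF.
Qed.

(* The value at the origin is irrelevant. *)
Definition normalize (u v : R) : S1 :=
  if pselect (0 < u ^+ 2 + v ^+ 2) is left h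
  then circle_point (normalize_subproof h)
  else expi 0.

Lemma cx_normalize u v : 0 < u ^+ 2 + v ^+ 2 ->
  cx (normalize u v) = u / Num.sqrt (u ^+ 2 + v ^+ 2).
Proof. by rewrite /normalize; case: pselect. Qed.

Lemma cy_normalize u v : 0 < u ^+ 2 + v ^+ 2 ->
  cy (normalize u v) = v / Num.sqrt (u ^+ 2 + v ^+ 2).
Proof. by rewrite /normalize; case: pselect. Qed.

Lemma normalizeZ (k : R) (p : S1) : 0 < k ->
  normalize (k * cx p) (k * cy p) = p.
Proof.
move=> k0; have e : (k * cx p) ^+ 2 + (k * cy p) ^+ 2 = k ^+ 2.
  by rewrite !exprMn -mulrDr circleE mulr1.
have k2 : 0 < k ^+ 2 by rewrite exprn_gt0.
by apply: circle_eq; rewrite ?cx_normalize ?cy_normalize e //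
  sqrtr_sqr gtr0_norm // mulrAC divff ?mul1r // gt_eqF.
Qed.

Lemma cvg_normalize (T : Type) (F : set_system T) (f g : T -> R) (u v : R) :
  Filter F -> f @ F --> u -> g @ F --> v -> 0 < u ^+ 2 + v ^+ 2 ->
  normalize (f t) (g t) @[t --> F] --> normalize u v.
Proof.
move=> FF fu gv uv.
have sq : f t ^+ 2 + g t ^+ 2 @[t --> F] --> u ^+ 2 + v ^+ 2.
  by under eq_fun do rewrite !expr2; rewrite !expr2; apply: cvgD; apply: cvgM.
have np : F [set t | 0 < f t ^+ 2 + g t ^+ 2].
  apply: (sq [set x | 0 < x]); apply: open_nbhs_nbhs.
  by split; [exact: open_gt|].
have rt : (Num.sqrt (f t ^+ 2 + g t ^+ 2))^-1 @[t --> F] -->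
    (Num.sqrt (u ^+ 2 + v ^+ 2))^-1.
  apply: cvgV; first by rewrite gt_eqF // sqrtr_gt0.
  exact: (cvg_comp _ _ sq (@sqrt_continuous R _)).
apply: cvg_circle.
  rewrite cx_normalize //; apply: cvg_trans (cvgM fu rt).
  by apply: near_eq_cvg; apply: filterS np => t /= h; rewrite cx_normalize.
rewrite cy_normalize //; apply: cvg_trans (cvgM gv rt).
by apply: near_eq_cvg; apply: filterS np => t /= h; rewrite cy_normalize.
Qed.

(** * Rules from nonvanishing families of plane curves *)

Lemma path_of_continuous (X : topologicalType) (f : I -> X) : continuous f ->
  exists s : path_space R X, forall t, s t = f t.
Proof.
move=> fc.
pose s : continuousType I X := HB.pack f (isContinuous.Build _ _ f fc).
by exists s.
Qed.

Lemma cvg_path_space (X : topologicalType) (T : Type) (F : set_system T)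
    (f : T -> path_space R X) (s : path_space R X) : Filter F ->
  (forall K O, compact K -> open O -> s @` K `<=` O ->
     F [set t | f t @` K `<=` O]) -> f @ F --> s.
Proof.
move=> FF fP U [_ [[W oW <-]] Ws] /filterS; apply.
have : {compact-open, (fun t => (f t : I -> X)) @ F --> (s : I -> X)}.
  by apply/compact_open_cvgP => K O cK oO sKO; exact: fP.
by move=> /(_ W); apply; apply: open_nbhs_nbhs; split.
Qed.

Section NormalizedHomotopy.
Variables (V : set (S1 * S1)) (hx hy : (S1 * S1) * R -> R).
Hypothesis V_open : open V.
Hypothesis hx_continuous : continuous hx.
Hypothesis hy_continuous : continuous hy.
Hypothesis h_neq0 : forall v t, V v -> 0 <= t <= 1 ->
  0 < hx (v, t) ^+ 2 + hy (v, t) ^+ 2.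
Hypothesis h_start : forall v, V v -> exists2 k, 0 < k &
  hx (v, 0) = k * cx v.1 /\ hy (v, 0) = k * cy v.1.
Hypothesis h_end : forall v, V v -> exists2 k, 0 < k &
  hx (v, 1) = k * cx v.2 /\ hy (v, 1) = k * cy v.2.
Hypothesis h_swap : forall x y t,
  hx ((y, x), t) = hx ((x, y), 1 - t) /\ hy ((y, x), t) = hy ((x, y), 1 - t).
Hypothesis V_sym : symmetric_set V.

Let curve v (t : R) : S1 := normalize (hx (v, t)) (hy (v, t)).

Let cvg_curve v (t : R) : V v -> 0 <= t <= 1 ->
  curve w.1 w.2 @[w --> (v, t)] --> curve v t.
Proof.
move=> Vv t01; apply: cvg_normalize; last exact: h_neq0.
  by under eq_fun do rewrite -surjective_pairing; exact: hx_continuous.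
by under eq_fun do rewrite -surjective_pairing; exact: hy_continuous.
Qed.

Let val01 (u : I) : 0 <= \val u <= 1.
Proof. by have := set_valP u; rewrite /unit_interval /= in_itv. Qed.

Let val_continuous : continuous (\val : I -> R).
Proof. exact: (@initial_continuous _ _ (@set_val R (unit_interval R))). Qed.

(** Joint continuity in pair and time gives continuity into the path space. The ends are prescribed
    only up to positive factors, which [normalize] removes. *)
Lemma normalized_rule :
  exists s : S1 * S1 -> path_space R S1,
    motion_planning_rule V s /\ symmetric_rule V s.
Proof.
have [s sP] : {s : S1 * S1 -> path_space R S1 &
    forall v, V v -> forall u : I, s v u = curve v (\val u)}.
  apply: (@choice _ _ (fun v (p : path_space R S1) =>
    V v -> forall u : I, p u = curve v (\val u))) => v.
  have [Vv|nV] := pselect (V v); last first.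
    have [p _] := @path_of_continuous S1 (cst (expi 0)) (fun t => cvg_cst _).
    by exists p.
  have [u|p pP] := @path_of_continuous S1 (fun u : I => curve v (\val u)).
    have c : (v, \val w) @[w --> u] --> (v, \val u).
      by apply: (cvg_pair (cvg_cst v) (@val_continuous u)).
    exact: (cvg_comp _ _ c (cvg_curve Vv (val01 u))).
  by exists p.
exists s; split; last first.
  move=> x y Vxy; apply/continuousEP => u.
  rewrite sP; last exact/V_sym.
  have [hxE hyE] := h_swap x y (\val u).
  by rewrite /reverse /= sP // /curve hxE hyE.
split.
  rewrite continuous_open_subspace // => v /set_mem Vv.
  apply: cvg_path_space => K O cK oO svK.
  have nV : nbhs v V by apply: open_nbhs_nbhs.
  (* Tube lemma over the compact set [K] of times; the guard [V w] is there because [s] is known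
     only on [V]. *)
  have : nbhs v [set w | K `<=` (fun u => V w -> O (s w u))].
    move/compact_near_coveringP : cK => cK.
    apply: (cK _ (nbhs v) (fun w u => V w -> O (s w u))) => u Ku.
    have c1 : (\val w.1 : R) @[w --> (u, v)] --> (\val u : R).
      exact: (cvg_comp _ _ (@cvg_fst _ _ (nbhs u) (nbhs v) _)
        (@val_continuous u)).
    have c2 : w.2 @[w --> (u, v)] --> v by exact: cvg_snd.
    have c : (w.2, \val w.1) @[w --> (u, v)] --> (v, \val u).
      exact: (cvg_pair c2 c1).
    have nO : nbhs (curve v (\val u)) O.
      apply: open_nbhs_nbhs; split=> //.
      by apply: svK; exists u => //; rewrite sP.
    have := cvg_comp _ _ c (cvg_curve Vv (val01 u)) O nO.
    apply: (@filterS _ (nbhs (u, v))) => -[u' w] /= Ow Vw; by rewrite sP.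
  by apply: filterS2 nV => w Vw Kw _ [u Ku <-]; exact: Kw.
move=> [x y] Vv; have [k k0 [kx ky]] := h_start Vv.
have [m m0 [mx my]] := h_end Vv.
rewrite /endpoints !sP // /curve /= kx ky mx my.
by rewrite !normalizeZ.
Qed.

End NormalizedHomotopy.

(* Where the second coordinate vanishes, the two weighted ordinates cancel,
   which forces [t] away from 0 and 1 relative to [q]; there the detour
   [8 t (1 - t)] beats the first coordinate. *)
Lemma detour_neq0 (x1 y1 x2 y2 t : R) :
  x1 ^+ 2 + y1 ^+ 2 = 1 -> x2 ^+ 2 + y2 ^+ 2 = 1 -> 0 < - (y1 * y2) ->
  0 <= t <= 1 ->
  0 < (- (y1 * y2) * ((1 - t) * x1 + t * x2) - t * (1 - t) * 8) ^+ 2 +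
      (- (y1 * y2) * ((1 - t) * y1 + t * y2)) ^+ 2.
Proof.
move=> c1 c2 q0 /andP[t0 t1].
set q := - (y1 * y2) in q0 *.
rewrite lt_neqAle addr_ge0 ?sqr_ge0 // andbT eq_sym paddr_eq0 ?sqr_ge0 //.
apply/negP => /andP[]; rewrite !sqrf_eq0 => /eqP hx0 /eqP hy0.
have y0 : (1 - t) * y1 + t * y2 = 0.
  by apply/eqP; move/eqP: hy0; rewrite mulf_eq0 gt_eqF.
have e1 : (1 - t) * y1 ^+ 2 = t * q.
  have -> : t * q = (1 - t) * y1 ^+ 2 - y1 * ((1 - t) * y1 + t * y2).
    by rewrite /q; ring.
  by rewrite y0 mulr0 subr0.
have e2 : (1 - t) * q = t * y2 ^+ 2.
  have -> : t * y2 ^+ 2 = (1 - t) * q + y2 * ((1 - t) * y1 + t * y2).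
    by rewrite /q; ring.
  by rewrite y0 mulr0 addr0.
have y1B : y1 ^+ 2 <= 1 by have := sqr_ge0 x1; lra.
have y2B : y2 ^+ 2 <= 1 by have := sqr_ge0 x2; lra.
have x1B : x1 <= 1 by nra.
have x2B : x2 <= 1 by nra.
have i1 : t * q <= 1 - t by rewrite -e1; nra.
have i2 : (1 - t) * q <= t by rewrite e2; nra.
have xB : (1 - t) * x1 + t * x2 <= 1 by nra.
have qx : q * ((1 - t) * x1 + t * x2) <= q by nra.
have t8 : t * (1 - t) * 8 <= q by lra.
(* By [i1] and [i2] the smaller of [t] and [1 - t] is at least [q / 2], the larger at least 1/2. So
   [t * (1 - t) * 8] is at least [2 * q], against [t8]; any constant above 4 would do. *)
case: (leP t (1 / 2)) => th; nra.
Qed.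

(** The weight [q] both cuts out the open set and scales the segment against the push. The push
    vanishes at both ends and is invariant under [t] to [1 - t], hence the correct ends and the
    symmetry. *)
Lemma weighted_rule (q : S1 * S1 -> R) (a b : R) : continuous q ->
  (forall x y, q (y, x) = q (x, y)) ->
  (forall x y t, 0 < q (x, y) -> 0 <= t <= 1 ->
     0 < (q (x, y) * ((1 - t) * cx x + t * cx y) - t * (1 - t) * a) ^+ 2 +
         (q (x, y) * ((1 - t) * cy x + t * cy y) - t * (1 - t) * b) ^+ 2) ->
  [/\ open [set v | 0 < q v], symmetric_set [set v | 0 < q v] &
     exists s : S1 * S1 -> path_space R S1,
       motion_planning_rule [set v | 0 < q v] s /\
       symmetric_rule [set v | 0 < q v] s].
Proof.
move=> qc qs q_neq0.
have oV : open [set v | 0 < q v].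
  apply: (@open_comp _ _ q [set x | 0 < x]) => [v _|]; first exact: qc.
  exact: open_gt.
have sV : symmetric_set [set v | 0 < q v] by move=> x y; rewrite /= qs.
split=> //.
have hc (c : S1 -> R) (k : R) : continuous c ->
  continuous (fun z : (S1 * S1) * R =>
    q z.1 * ((1 - z.2) * c z.1.1 + z.2 * c z.1.2) - z.2 * (1 - z.2) * k).
  move=> cc z.
  have c1 : w.1 @[w --> z] --> z.1 by exact: cvg_fst.
  have c2 : w.2 @[w --> z] --> z.2 by exact: cvg_snd.
  have c11 : w.1.1 @[w --> z] --> z.1.1.
    by apply: (cvg_comp _ _ c1); exact: cvg_fst.
  have c12 : w.1.2 @[w --> z] --> z.1.2.
    by apply: (cvg_comp _ _ c1); exact: cvg_snd.
  have qz := cvg_comp _ _ c1 (qc z.1).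
  have cz1 := cvg_comp _ _ c11 (cc z.1.1).
  have cz2 := cvg_comp _ _ c12 (cc z.1.2).
  have t1 : 1 - w.2 @[w --> z] --> 1 - z.2 by apply: cvgB; [exact: cvg_cst|].
  apply: cvgB; last by apply: cvgM; [apply: cvgM|exact: cvg_cst].
  by apply: cvgM => //; apply: cvgD; apply: cvgM.
apply: (normalized_rule oV (hc _ a (@cx_continuous R))
  (hc _ b (@cy_continuous R))) => //=.
- by move=> [x y] t /= /q_neq0 h /h.
- by move=> [x y] /= qv; exists (q (x, y)) => //; split; ring.
- by move=> [x y] /= qv; exists (q (x, y)) => //; split; ring.
- by move=> x y t /=; rewrite qs; split; ring.
Qed.

Lemma circle_cover3 : symmetric_planning_cover R S1 3.
Proof.
have prodc (c : S1 -> R) : continuous c ->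
    continuous (fun v : S1 * S1 => - (c v.1 * c v.2)).
  move=> cc v; apply: cvgN; apply: cvgM.
    exact: (cvg_comp _ _ (@cvg_fst _ _ (nbhs v.1) (nbhs v.2) _) (cc v.1)).
  exact: (cvg_comp _ _ (@cvg_snd _ _ (nbhs v.1) (nbhs v.2) _) (cc v.2)).
(* Positive, respectively, off the antipodal pairs, where the ordinates have opposite signs, and
   where the abscissas do. *)
pose q (i : 'I_3) (v : S1 * S1) : R := match val i with
  | 0 => 1 + dot v.1 v.2
  | 1 => - (cy v.1 * cy v.2)
  | _ => - (cx v.1 * cx v.2)
  end.
exists (fun i => [set v | 0 < q i v]); split.
  case=> [[|[|[|//]]] i3]; rewrite /q /=.
  - apply: (@weighted_rule _ 0 0).
    + move=> v; apply: cvgD; first exact: cvg_cst.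
      by apply: cvg_dot; [exact: cvg_fst|exact: cvg_snd].
    + by move=> x y; rewrite /dot /=; ring.
    + move=> x y t /= d0 /andP[t0 t1]; rewrite !mulr0 !subr0 !exprMn -mulrDr.
      apply: mulr_gt0; first by rewrite exprn_gt0.
      have -> : ((1 - t) * cx x + t * cx y) ^+ 2 +
          ((1 - t) * cy x + t * cy y) ^+ 2 =
          (1 - t) ^+ 2 * (cx x ^+ 2 + cy x ^+ 2) +
          t ^+ 2 * (cx y ^+ 2 + cy y ^+ 2) + 2 * (t * (1 - t)) * dot x y.
        by rewrite /dot; ring.
      rewrite !circleE !mulr1.
      (* Two nonnegative terms: the square vanishes only at t = 1/2, where the other is positive. *)
      have -> : (1 - t) ^+ 2 + t ^+ 2 + 2 * (t * (1 - t)) * dot x y =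
        (1 - 2 * t) ^+ 2 + 2 * (t * (1 - t)) * (1 + dot x y) by ring.
      have [->|tn] := eqVneq t (1 / 2).
        by apply: ltr_wpDl; [exact: sqr_ge0|rewrite mulr_gt0 //; lra].
      apply: ltr_pwDl; last by rewrite !mulr_ge0 ?subr_ge0 // ltW.
      rewrite lt_neqAle sqr_ge0 andbT eq_sym sqrf_eq0 subr_eq0.
      by apply: contra_neqN tn => /eqP; lra.
  - apply: (@weighted_rule _ 8 0); first by apply: prodc; exact: cy_continuous.
      by move=> x y /=; ring.
    move=> x y t /= q0 t01; rewrite !mulr0 !subr0.
    by apply: detour_neq0; rewrite ?circleE.
  - apply: (@weighted_rule _ 0 8); first by apply: prodc; exact: cx_continuous.
      by move=> x y /=; ring.
    move=> x y t /= q0 t01; rewrite !mulr0 !subr0 addrC.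
    by apply: detour_neq0; rewrite // addrC ?circleE.
apply/seteqP; split=> // -[x y] _.
have [d0|d0] := ltP 0 (1 + dot x y); first by exists ord0.
(* Off the first set this forces [y = - x]; the two other weights are then squares with sum 1. *)
have xyE : (cx x + cx y) ^+ 2 + (cy x + cy y) ^+ 2 = 2 * (1 + dot x y).
  have -> : (cx x + cx y) ^+ 2 + (cy x + cy y) ^+ 2 =
    (cx x ^+ 2 + cy x ^+ 2) + (cx y ^+ 2 + cy y ^+ 2) + 2 * dot x y.
    by rewrite /dot; ring.
  by rewrite !circleE; ring.
have sx := sqr_ge0 (cx x + cx y); have sy := sqr_ge0 (cy x + cy y).
have /eqP : (cx x + cx y) ^+ 2 = 0 by lra.
have /eqP : (cy x + cy y) ^+ 2 = 0 by lra.
rewrite !sqrf_eq0 !addr_eq0 => /eqP yE /eqP xE.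
have := circleE y => cE.
have [y0|y0] := ltP 0 (cy y ^+ 2).
  by exists (inord 1) => //; rewrite /q /= inordK //= yE mulNr opprK -expr2.
by exists (inord 2) => //; rewrite /q /= inordK //= xE mulNr opprK -expr2; lra.
Qed.

End UpperBound.

(** * The exact number of sets *)

Lemma not_cover2 (R : realType) (n : nat) :
  symmetric_planning_cover R (circle R) n -> (2 < n)%N.
Proof.
move=> [V [VP Vcov]]; rewrite ltnNge; apply/negP => n2.
(* A cover by fewer than two sets is padded with empty ones: [insub] fails on an index that is not
   below [n]. *)
pose W (b : bool) : set (circle R * circle R) :=
  if insub (nat_of_bool b) is Some i then V i else set0.
have WP b : [/\ open (W b), symmetric_set (W b) &
    exists s : _ -> path_space R (circle R),
      motion_planning_rule (W b) s /\ symmetric_rule (W b) s].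
  rewrite /W; case: insub => [i|]; first exact: VP.
  split; [exact: open0|by []|].
  have [s _] := @path_of_continuous R (circle R) (cst (expi 0))
    (fun t => cvg_cst _).
  exists (cst s); split=> //; split=> //.
  by move=> v; exact: cvg_cst.
have Wcov v : exists b, W b v.
  have [i _ Vi] : (\bigcup_i V i) v by rewrite Vcov.
  have i2 : (i < 2)%N by apply: leq_trans n2.
  exists (i == 1%N :> nat); rewrite /W.
  have -> : nat_of_bool (i == 1%N :> nat) = i.
    by case: (nat_of_ord i) i2 => [|[]].
  by rewrite valK.
have [s sP] : {s : bool -> _ -> path_space R (circle R) &
    forall b, motion_planning_rule (W b) (s b) /\ symmetric_rule (W b) (s b)}.
  by apply: (@choice _ _ (fun b (s : _ -> path_space R (circle R)) =>
    motion_planning_rule (W b) s /\ symmetric_rule (W b) s)) => b;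
  have [] := WP b.
apply: (@no_symmetric_pair_cover R W s) => // b.
- by have [] := WP b.
- by have [] := WP b.
- by have [] := sP b.
- by have [] := sP b.
Qed.

Theorem theorem1p1 (R : realType) : TCSigma R (circle R) = 2%:E.
Proof.
apply: (iffRL (TCSigmaP R (circle R) 2)).
by split; [exact: circle_cover3|exact: not_cover2].
Qed.
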